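(* Let $\mathbb{K}$ be a field of characteristic $0$, $\ell\ge 2$, and let $N=(N_2,\ldots,N_\ell)$ be finite subsets of $\mathbb{K}$ with $N_2\subseteq N_3\subseteq\cdots\subseteq N_\ell$. Let $\mathcal{I}_N$ be the central arrangement in $\mathbb{K}^{\ell+1}$ (coordinates $x_1,\ldots,x_\ell,z$) with defining polynomial $Q(\mathcal{I}_N)= z\big(\prod_{j=2}^{\ell}\prod_{a\in N_j}(x_1-x_j-az)\big)\big(\prod_{2\le i<j\le \ell}(x_i-x_j)\big)$. Define \[\theta_0=\sum_{i=1}^{\ell}\frac{\partial}{\partial x_i},\qquad \theta_1=\sum_{i=1}^{\ell}x_i\frac{\partial}{\partial x_i}+z\frac{\partial}{\partial z},\] \[\theta_k=\sum_{s=2}^{k}\Big(\prod_{a\in N_k}(x_1-x_s-az)\prod_{t=k+1}^{\ell}(x_s-x_t)\Big)\frac{\partial}{\partial x_s}\quad(2\le k\le\ell).\] Then $\theta_0,\theta_1,\ldots,\theta_\ell$ form a basis of the $S$-module $D(\mathcal{I}_N)$. In particular $\mathcal{I}_N$ is free with exponents \[\exp\mathcal{I}_N=(0,\,1,\,|N_2|+\ell-2,\,|N_3|+\ell-3,\,\ldots,\,|N_\ell|).\]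
   Context: $S=\mathbb{K}[x_1,\ldots,x_\ell,z]$. For a central arrangement $\mathcal{A}$, $D(\mathcal{A})=\{\theta\in\mathrm{Der}_{\mathbb{K}}(S)\mid\theta(\alpha_H)\in\alpha_H S\text{ for all }H\in\mathcal{A}\}$, with $\alpha_H$ a linear form defining $H$. $\mathcal{A}$ is free if $D(\mathcal{A})$ is a free $S$-module; its exponents are the degrees of a homogeneous basis. $|N_j|$ is the cardinality of $N_j$. *)

(* Defs.v *)
From HB Require Import structures.
From mathcomp Require Import all_boot all_order all_algebra.
From mathcomp Require Import zify finmap mpoly.

Set Implicit Arguments.
Unset Strict Implicit.
Unset Printing Implicit Defensive.

Import GRing.Theory.
Local Open Scope ring_scope.

Definition is_derivation (K : fieldType) (n : nat)
    (d : {mpoly K[n]} -> {mpoly K[n]}) : Prop :=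
  linear d /\ forall f g, d (f * g) = d f * g + f * d g.

(* Polynomial degree: writing d = \sum_i f_i d/dx_i, all the coefficients
   f_i = d x_i are homogeneous of degree e. *)
Definition homogeneous_derivation (K : fieldType) (n e : nat)
    (d : {mpoly K[n]} -> {mpoly K[n]}) : Prop :=
  forall i : 'I_n, d 'X_i \is e.-homog.

(* A submodule of Der(S) is a predicate on maps S -> S, S acting pointwise. *)
Definition is_basis (K : fieldType) (n m : nat)
    (D : ({mpoly K[n]} -> {mpoly K[n]}) -> Prop)
    (b : 'I_m -> {mpoly K[n]} -> {mpoly K[n]}) : Prop :=
  [/\ forall i, D (b i),
      forall d, D d -> exists c : 'I_m -> {mpoly K[n]},
        forall f, d f = \sum_i c i * b i f
    & forall c : 'I_m -> {mpoly K[n]},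
        (forall f, \sum_i c i * b i f = 0) -> forall i, c i = 0].

Record central_arrangement (K : fieldType) (n : nat) := CentralArrangement {
  hyperplanes :> seq {vspace 'rV[K]_n};
  hyperplanes_uniq : uniq hyperplanes;
  hyperplanes_codim1 : all (fun H => (\dim H).+1 == n) hyperplanes
}.

Definition linear_form_of (K : fieldType) (n : nat)
    (H : {vspace 'rV[K]_n}) (alpha : {mpoly K[n]}) : Prop :=
  [/\ alpha \is 1.-homog, alpha != 0
    & forall v : 'rV[K]_n, (v \in H) = (alpha.@[fun i => v 0 i] == 0)].

Definition defining_polynomial (K : fieldType) (n : nat)
    (A : central_arrangement K n) (Q : {mpoly K[n]}) : Prop :=
  exists alpha : {vspace 'rV[K]_n} -> {mpoly K[n]},
    (forall H, H \in hyperplanes A -> linear_form_of H (alpha H)) /\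
    Q = \prod_(H <- hyperplanes A) alpha H.

(* The condition does not depend on the choice of the form alpha of H, which
   is unique up to a nonzero scalar. *)
Definition logarithmic_derivation (K : fieldType) (n : nat)
    (A : central_arrangement K n) (d : {mpoly K[n]} -> {mpoly K[n]}) : Prop :=
  is_derivation d /\
  forall H alpha, H \in hyperplanes A -> linear_form_of H alpha ->
    exists q, d alpha = alpha * q.

(* Finite bases suffice: D(A) is a submodule of the Noetherian module Der(S). *)
Definition free_arrangement (K : fieldType) (n : nat)
    (A : central_arrangement K n) : Prop :=
  exists (m : nat) (b : 'I_m -> {mpoly K[n]} -> {mpoly K[n]}),
    is_basis (logarithmic_derivation A) b.

Definition has_exponents (K : fieldType) (n : nat)
    (A : central_arrangement K n) (e : seq nat) : Prop :=
  exists (m : nat) (b : 'I_m -> {mpoly K[n]} -> {mpoly K[n]}) (deg : 'I_m -> nat),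
    [/\ is_basis (logarithmic_derivation A) b,
        forall i, homogeneous_derivation (deg i) (b i)
      & perm_eq e (codom deg)].

(* The coordinates x_1, ..., x_l, z are the variables 0, ..., l of
   {mpoly K[l.+1]}; [var_index i] is only meaningful for 1 <= i <= l. *)
Definition var_index (l i : nat) : 'I_l.+1 := inord i.-1.

Definition xvar (K : fieldType) (l i : nat) : {mpoly K[l.+1]} :=
  'X_(var_index l i).
Definition zvar (K : fieldType) (l : nat) : {mpoly K[l.+1]} := 'X_ord_max.
Arguments xvar {K l}.
Arguments zvar {K l}.

Definition dx (K : fieldType) (l i : nat) (f : {mpoly K[l.+1]}) :
  {mpoly K[l.+1]} := f^`M(var_index l i).
Definition dz (K : fieldType) (l : nat) (f : {mpoly K[l.+1]}) :
  {mpoly K[l.+1]} := f^`M(ord_max).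

(* Only the values N j with 2 <= j <= l are used. *)
Definition Q_N (K : fieldType) (l : nat) (N : nat -> {fset K}) :
    {mpoly K[l.+1]} :=
  zvar
  * (\prod_(2 <= j < l.+1) \prod_(a <- N j) (xvar 1 - xvar j - a *: zvar))
  * (\prod_(2 <= i < l.+1) \prod_(i.+1 <= j < l.+1) (xvar i - xvar j)).

Definition theta (K : fieldType) (l : nat) (N : nat -> {fset K}) (k : nat)
    (f : {mpoly K[l.+1]}) : {mpoly K[l.+1]} :=
  match k with
  | 0 => \sum_(1 <= i < l.+1) dx i f
  | 1 => \sum_(1 <= i < l.+1) xvar i * dx i f + zvar * dz f
  | _ => \sum_(2 <= s < k.+1)
           ((\prod_(a <- N k) (xvar 1 - xvar s - a *: zvar))
            * \prod_(k.+1 <= t < l.+1) (xvar s - xvar t)) * dx s f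
  end.

Section Existence.
Variable K : fieldType.

Definition form_of_row (n : nat) (c : 'rV[K]_n) : {mpoly K[n]} :=
  \sum_i c 0 i *: 'X_i.

Definition kernel_of_row (n : nat) (c : 'rV[K]_n) : {vspace 'rV[K]_n} :=
  lker (linfun (mulmxr c^T)).

(* The first nonzero coordinate of c is 1. *)
Definition normalized (n : nat) (c : 'rV[K]_n) : Prop :=
  exists2 i, c 0 i = 1 & forall j : 'I_n, (j < i)%N -> c 0 j = 0.

Lemma meval_form_of_row n (c v : 'rV[K]_n) :
  (form_of_row c).@[fun i => v 0 i] = (v *m c^T) 0 0.
Proof.
rewrite /form_of_row raddf_sum mxE; apply: eq_bigr => i _.
by rewrite /= mevalZ mevalXU mxE mulrC.
Qed.

Lemma mem_kernel_of_row n (c v : 'rV[K]_n) :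
  (v \in kernel_of_row c) = ((v *m c^T) 0 0 == 0).
Proof.
rewrite memv_ker lfunE /=; apply/eqP/eqP => [->|h]; first by rewrite mxE.
by apply/rowP => i; rewrite ord1 h mxE.
Qed.

Lemma delta_form n (c : 'rV[K]_n) i : ((delta_mx 0 i : 'rV[K]_n) *m c^T) 0 0 = c 0 i.
Proof. by rewrite -rowE !mxE. Qed.

Lemma form_of_rowP n (c : 'rV[K]_n) :
  c != 0 -> linear_form_of (kernel_of_row c) (form_of_row c).
Proof.
move=> c_neq0; split.
- by apply: rpred_sum => i _; apply/rpredZ; rewrite dhomogX /= mdeg1.
- apply: contra_neq c_neq0 => c0; apply/rowP => i.
  by rewrite -delta_form -meval_form_of_row c0 meval0 mxE.
- by move=> v; rewrite mem_kernel_of_row meval_form_of_row.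
Qed.

Lemma dim_kernel_of_row n (c : 'rV[K]_n) :
  c != 0 -> (\dim (kernel_of_row c)).+1 = n.
Proof.
move=> c_neq0; pose f := linfun (mulmxr c^T) : 'Hom('rV[K]_n, 'rV[K]_1).
have := limg_ker_dim f fullv.
rewrite capfv dimvf /dim /= mul1n => dimE; rewrite -[RHS]dimE -addn1; congr addn.
apply/eqP; rewrite eqn_leq; apply/andP; split; last first.
  by rewrite (leq_trans (dimvS (subvf _))) // dimvf.
rewrite lt0n dimv_eq0; apply: contra_neq c_neq0 => f0.
apply/rowP => i; rewrite -delta_form [RHS]mxE.
have : f (delta_mx 0 i) \in limg f by rewrite memv_img ?memvf.
by rewrite f0 memv0 lfunE /= => /eqP ->; rewrite mxE.
Qed.

Lemma normalized_neq0 n (c : 'rV[K]_n) : normalized c -> c != 0.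
Proof.
by case=> i ci _; apply/eqP => c0; move/eqP: ci; rewrite c0 mxE eq_sym oner_eq0.
Qed.

Lemma kernel_of_row_inj n (c d : 'rV[K]_n) : normalized c -> normalized d ->
  kernel_of_row c = kernel_of_row d -> c = d.
Proof.
move=> [i ci ltc] [k dk ltd] eq_ker.
have dE j : d 0 j = c 0 j * d 0 i.
  pose v : 'rV[K]_n := delta_mx 0 j - c 0 j *: delta_mx 0 i.
  have vE (b : 'rV[K]_n) : (v *m b^T) 0 0 = b 0 j - c 0 j * b 0 i.
    by rewrite mulmxBl -scalemxAl mxE delta_form; congr (_ + _);
    rewrite mxE; congr (- _); rewrite mxE delta_form.
  have : v \in kernel_of_row c by rewrite mem_kernel_of_row vE ci mulr1 subrr.
  by rewrite eq_ker mem_kernel_of_row vE subr_eq0 => /eqP.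
have di : d 0 i = 1.
  case: (ltngtP i k) => [ltik|ltki|/val_inj eq_ik]; last by rewrite eq_ik.
    by move/eqP: dk; rewrite dE (ltd _ ltik) mulr0 eq_sym oner_eq0.
  by move/eqP: dk; rewrite dE (ltc _ ltki) mul0r eq_sym oner_eq0.
by apply/rowP => j; rewrite dE di mulr1.
Qed.

Lemma arrangement_of_rows n (L : seq 'rV[K]_n) : uniq L ->
    (forall c, c \in L -> normalized c) ->
  exists A : central_arrangement K n,
    defining_polynomial A (\prod_(c <- L) form_of_row c).
Proof.
move=> uniqL normL; pose s := [seq kernel_of_row c | c <- L].
have inj_ker : {in L &, injective (@kernel_of_row n)}.
  by move=> c d cL dL; apply: kernel_of_row_inj; apply: normL.
have uniq_s : uniq s by rewrite map_inj_in_uniq.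
have codim_s : all (fun H : {vspace _} => (\dim H).+1 == n) s.
  apply/allP => _ /mapP[c cL ->].
  by rewrite dim_kernel_of_row // normalized_neq0 //; apply: normL.
exists (CentralArrangement uniq_s codim_s).
exists (fun H => form_of_row (nth 0 L (index H s))).
have nthE c : c \in L -> nth 0 L (index (kernel_of_row c) s) = c.
  move=> cL; have ks : kernel_of_row c \in s by rewrite map_f.
  have lt_s : (index (kernel_of_row c) s < size L)%N.
    by rewrite -(size_map (@kernel_of_row n)) index_mem.
  apply: inj_ker => //; first exact: mem_nth.
  by rewrite -(nth_map 0 fullv) // nth_index.
split=> [_ /mapP[c cL ->]|].
  by rewrite nthE //; apply/form_of_rowP/normalized_neq0/normL.
by rewrite /= big_map; apply: eq_big_seq => c cL; rewrite nthE.
Qed.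

Lemma form_of_rowB n (c d : 'rV[K]_n) :
  form_of_row (c - d) = form_of_row c - form_of_row d.
Proof.
by rewrite /form_of_row -sumrB; apply: eq_bigr => i _; rewrite !mxE scalerBl.
Qed.

Lemma form_of_rowZ n a (c : 'rV[K]_n) :
  form_of_row (a *: c) = a *: form_of_row c.
Proof.
by rewrite /form_of_row scaler_sumr; apply: eq_bigr => i _; rewrite mxE scalerA.
Qed.

Lemma form_of_row_delta n (i : 'I_n) : form_of_row (delta_mx 0 i) = 'X_i.
Proof.
rewrite /form_of_row (bigD1 i) //= big1 ?addr0 => [|j /negPf neq_ji].
  by rewrite mxE !eqxx scale1r.
by rewrite mxE neq_ji andbF scale0r.
Qed.

Theorem I_N_exists (l : nat) (N : nat -> {fset K}) : (2 <= l)%N ->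
  exists I_N : central_arrangement K l.+1, defining_polynomial I_N (Q_N l N).
Proof.
move=> l_ge2.
pose e i : 'rV[K]_l.+1 := delta_mx 0 (var_index l i).
pose ez : 'rV[K]_l.+1 := delta_mx 0 ord_max.
pose r1 j a := e 1%N - e j - a *: ez.
pose r2 i j := e i - e j.
pose L1 := [seq r1 j a | j <- index_iota 2 l.+1, a <- N j].
pose L2 := [seq r2 i j | i <- index_iota 2 l.+1, j <- index_iota i.+1 l.+1].
have fe i : form_of_row (e i) = xvar i by apply: form_of_row_delta.
have fez : form_of_row ez = zvar by apply: form_of_row_delta.
have -> : Q_N l N = \prod_(c <- ez :: (L1 ++ L2)) form_of_row c.
  rewrite big_cons big_cat /= /Q_N -mulrA fez; congr (_ * (_ * _)).
    rewrite big_allpairs_dep; apply: eq_bigr => j _; apply: eq_bigr => a _.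
    by rewrite !form_of_rowB form_of_rowZ !fe fez.
  rewrite big_allpairs_dep; apply: eq_bigr => i _; apply: eq_bigr => j _.
  by rewrite form_of_rowB !fe.
have eE i k : (i <= l)%N -> e i 0 k = (val k == i.-1)%:R.
  move=> il; rewrite mxE eqxx -val_eqE /= inordK //.
  by rewrite ltnS (leq_trans (leq_pred i)).
have ezE k : ez 0 k = (val k == l)%:R by rewrite mxE eqxx -val_eqE.
have rowB3 (b c d : 'rV[K]_l.+1) a k :
    (b - c - a *: d) 0 k = b 0 k - c 0 k - a * d 0 k by rewrite !mxE.
have rowB2 (b c : 'rV[K]_l.+1) k : (b - c) 0 k = b 0 k - c 0 k by rewrite !mxE.
have r1E j a k : (1 < j <= l)%N -> r1 j a 0 k =
    (val k == 0)%:R - (val k == j.-1)%:R - a * (val k == l)%:R.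
  by case/andP=> _ jl; rewrite /r1 rowB3 !eE ?ezE // ltnW.
have r2E i j k : (i < j <= l)%N -> r2 i j 0 k =
    (val k == i.-1)%:R - (val k == j.-1)%:R.
  case/andP=> ij jl; rewrite /r2 rowB2 !eE //.
  exact: ltnW (leq_trans ij jl).
have idx m : (m <= l)%N -> exists k : 'I_l.+1, val k = m.
  by move=> ml; exists (inord m); rewrite /= inordK.
apply: arrangement_of_rows.
  rewrite cons_uniq cat_uniq mem_cat negb_or -andbA; apply/and5P; split.
  - apply/allpairsPdep => -[j [a [jl aN]]].
    move: jl; rewrite mem_index_iota ltnS => jl.
    move/rowP/(_ ord0); rewrite r1E // ezE /=.
    have -> : (0 == l)%N = false by lia.
    have -> : (0 == j.-1)%N = false by lia.
    by move/eqP; rewrite ?eqxx mulr0 !subr0 eq_sym oner_eq0.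
  - apply/allpairsPdep => -[i [j []]].
    rewrite !mem_index_iota !ltnS => il jl.
    move/rowP/(_ ord_max); rewrite r2E // ezE /=.
    have -> : (l == i.-1)%N = false by lia.
    have -> : (l == j.-1)%N = false by lia.
    by move/eqP; rewrite ?eqxx subrr oner_eq0.
  - apply: allpairs_uniq_dep => [|j _|]; first exact: iota_uniq.
      exact: fset_uniq.
    move=> _ _ /allpairsPdep[j [a [jl aN ->]]] /allpairsPdep[j' [a' [jl' aN' ->]]].
    move: jl jl'; rewrite !mem_index_iota !ltnS /= => jl jl' /rowP eq_r.
    have eq_a : a = a'.
      have := eq_r ord_max; rewrite !r1E //= ?eqxx.
      have -> : (l == 0)%N = false by lia.
      have -> : (l == j.-1)%N = false by lia.
      have -> : (l == j'.-1)%N = false by lia.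
      by rewrite !mulr1 !subr0 !sub0r => /oppr_inj.
    have [|k kE] := idx j.-1; first by lia.
    have := eq_r k; rewrite !r1E // kE ?eqxx.
    have -> : (j.-1 == 0)%N = false by lia.
    have -> : (j.-1 == l)%N = false by lia.
    rewrite !mulr0 !subr0 !sub0r => /oppr_inj.
    case: (j.-1 =P j'.-1) => [eq_j _|_ /eqP]; last by rewrite oner_eq0.
    by rewrite eq_a; have -> : j = j' by lia.
  - apply/hasPn => _ /allpairsPdep[i [j [il jl ->]]].
    apply/allpairsPdep => -[j' [a [jl' aN]]].
    move: il jl jl'; rewrite !mem_index_iota !ltnS => il jl jl'.
    move/rowP/(_ ord0); rewrite r1E // r2E //=.
    have -> : (0 == i.-1)%N = false by lia.
    have -> : (0 == j.-1)%N = false by lia.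
    have -> : (0 == j'.-1)%N = false by lia.
    have -> : (0 == l)%N = false by lia.
    by move/eqP; rewrite mulr0 !subr0 eq_sym oner_eq0.
  apply: allpairs_uniq_dep => [|i _|]; try exact: iota_uniq.
  move=> _ _ /allpairsPdep[i [j [il jl ->]]] /allpairsPdep[i' [j' [il' jl' ->]]].
  move: il jl il' jl'; rewrite !mem_index_iota !ltnS /= => il jl il' jl' /rowP eq_r.
  have eq_i : i = i'.
    case: (ltngtP i i') => // lti.
      have [|k kE] := idx i.-1; first by lia.
      have := eq_r k; rewrite !r2E // kE ?eqxx.
      have -> : (i.-1 == j.-1)%N = false by lia.
      have -> : (i.-1 == i'.-1)%N = false by lia.
      have -> : (i.-1 == j'.-1)%N = false by lia.
      by move/eqP; rewrite !subr0 oner_eq0.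
    have [|k kE] := idx i'.-1; first by lia.
    have := eq_r k; rewrite !r2E // kE ?eqxx.
    have -> : (i'.-1 == j.-1)%N = false by lia.
    have -> : (i'.-1 == i.-1)%N = false by lia.
    have -> : (i'.-1 == j'.-1)%N = false by lia.
    by move/eqP; rewrite !subr0 eq_sym oner_eq0.
  have [|k kE] := idx j.-1; first by lia.
  have := eq_r k; rewrite !r2E // kE ?eqxx -eq_i.
  have -> : (j.-1 == i.-1)%N = false by lia.
  rewrite !sub0r => /oppr_inj.
  case: (j.-1 =P j'.-1) => [eq_j _|_ /eqP]; last by rewrite oner_eq0.
  by rewrite eq_i; have -> : j = j' by lia.
move=> c; rewrite inE mem_cat => /or3P[/eqP->||].
- exists ord_max => [|k]; first by rewrite ezE /= ?eqxx.
  by rewrite ezE /= => /ltn_eqF ->.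
- case/allpairsPdep=> j [a [jl aN ->]].
  move: jl; rewrite mem_index_iota ltnS => jl.
  exists ord0 => [|k] //; rewrite r1E //=.
  have -> : (0 == j.-1)%N = false by lia.
  have -> : (0 == l)%N = false by lia.
  by rewrite mulr0 !subr0.
- case/allpairsPdep=> i [j [il jl ->]].
  move: il jl; rewrite !mem_index_iota !ltnS => il jl.
  have [|k kE] := idx i.-1; first by lia.
  exists k => [|k'].
    by rewrite r2E // kE eqxx (_ : (i.-1 == j.-1)%N = false) ?subr0 //; lia.
  rewrite (_ : (k' < k)%N = (val k' < val k)%N) // kE => ltk; rewrite r2E //.
  have -> : (val k' == i.-1) = false by move: ltk; rewrite /=; lia.
  have -> : (val k' == j.-1) = false by move: ltk; rewrite /=; lia.
  by rewrite subrr.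
Qed.

End Existence.

(* Main.v *)
(* Write F_k(y) = \prod_(a in N_k) (x_1 - y - a z) \prod_(t > k) (y - x_t). For
   k >= 2 and every 2 <= s <= l one has theta_k x_s = F_k(x_s), since F_k(x_s)
   vanishes for s > k; hence x_i - x_j divides theta_k (x_i - x_j), and the
   other conditions follow from N_s being contained in N_k for s <= k.
   A logarithmic derivation d can be corrected
   by multiples of theta_1 and theta_0 so as to kill z and x_1. If it also
   kills x_t for all t > k, then d x_k is divisible by the pairwise
   non-associated primes x_1 - x_k - a z (a in N_k) and x_k - x_t (t > k), so by
   their product F_k(x_k) = theta_k x_k, and subtracting a multiple of theta_k
   kills x_k too. The same triangularity gives independence. *)
Require Import Defs.
From HB Require Import structures.
From mathcomp Require Import all_boot all_order all_algebra.
From mathcomp Require Import finmap mpoly zify ring.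

Set Implicit Arguments.
Unset Strict Implicit.
Unset Printing Implicit Defensive.

Import GRing.Theory.
Local Open Scope ring_scope.

(** * Divisibility in a commutative ring *)

Section Divides.
Variable R : comNzRingType.
Implicit Types p q r : R.

Definition divides p q := exists r, q = p * r.

Lemma divides_refl p : divides p p.
Proof. by exists 1; rewrite mulr1. Qed.

Lemma divides0 p : divides p 0.
Proof. by exists 0; rewrite mulr0. Qed.

Lemma dividesD p q r : divides p q -> divides p r -> divides p (q + r).
Proof. by case=> a -> [b ->]; exists (a + b); rewrite mulrDr. Qed.

Lemma dividesMl p q r : divides p q -> divides p (r * q).
Proof. by case=> a ->; exists (r * a); rewrite mulrCA. Qed.

Lemma dividesMr p q r : divides p q -> divides p (q * r).
Proof. by rewrite mulrC; apply: dividesMl. Qed.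

Lemma dividesN p q : divides p q -> divides p (- q).
Proof. by rewrite -mulN1r; apply: dividesMl. Qed.

Lemma divides_trans q p r : divides p q -> divides q r -> divides p r.
Proof. by move=> pq [c ->]; apply: dividesMr. Qed.

Lemma divides_prod (I : eqType) (s : seq I) (F : I -> R) i :
  i \in s -> divides (F i) (\prod_(j <- s) F j).
Proof. by move=> si; rewrite (big_rem i) //=; apply/dividesMr/divides_refl. Qed.

(** Since y is a root of P - P(y), the factor 'X - y splits off; evaluate the factorization at x. *)
Lemma divides_hornerB (P : {poly R}) x y : divides (x - y) (P.[x] - P.[y]).
Proof.
have /factor_theorem[Q PE] : root (P - P.[y]%:P) y.
  by rewrite /root !hornerE subrr.
have /(congr1 (horner^~ x)) := PE.
by rewrite !hornerE => ->; exists Q.[x]; rewrite mulrC.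
Qed.

End Divides.

(** * Linear forms as primes of the polynomial ring *)

Section LinearForms.
Variables (K : fieldType) (n : nat).
Implicit Types (p q f g alpha beta : {mpoly K[n]}) (v : 'rV[K]_n).

(** The part of [linear_form_of] that does not mention a hyperplane, as a boolean. *)
Definition linear_form p := (p \is 1.-homog) && (p != 0).

Lemma homog1E p : p \is 1.-homog -> p = \sum_i p@_U_(i) *: 'X_i.
Proof.
move=> p_hom; apply/mpolyP => m; rewrite raddf_sum /=.
have [/mdeg1P[j /eqP ->]|m_neq1] := boolP (mdeg m == 1%N).
  rewrite (bigD1 j) //= mcoeffZ mcoeffXU eqxx mulr1 big1 ?addr0 // => i neq_ij.
  by rewrite mcoeffZ mcoeffXU (negPf neq_ij) mulr0.
rewrite big1 => [|i _]; last first.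
  rewrite mcoeffZ mcoeffX; case: eqP => [im|]; last by rewrite mulr0.
  by rewrite -im mdeg1 eqxx in m_neq1.
apply: memN_msupp_eq0; apply: contra m_neq1 => mp.
by have /dhomogP/(_ _ mp) /= -> := p_hom.
Qed.

Lemma meval_homog1 p (v : 'I_n -> K) :
  p \is 1.-homog -> p.@[v] = \sum_i p@_U_(i) * v i.
Proof.
move/homog1E=> {1}->; rewrite raddf_sum; apply: eq_bigr => i _.
by rewrite /= mevalZ mevalXU.
Qed.

Lemma linear_form_coeff alpha :
  linear_form alpha -> exists i : 'I_n, alpha@_U_(i) != 0.
Proof.
case/andP=> /homog1E alphaE alpha_neq0; apply/existsP/existsPn => alpha0.
move/eqP: alpha_neq0; apply; rewrite alphaE big1 // => i _.
by have := alpha0 i; rewrite negbK => /eqP ->; rewrite scale0r.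
Qed.

(** Serves to refute divisibility: exhibit a point where p vanishes and q does not. *)
Lemma meval_divides p q (v : 'I_n -> K) :
  divides p q -> p.@[v] = 0 -> q.@[v] = 0.
Proof. by case=> r -> p0; rewrite mevalM p0 mul0r. Qed.

(* Solving alpha = 0 for a variable gives a retraction of S onto a domain
   whose kernel is generated by alpha. *)
Lemma linear_form_prime alpha f g : linear_form alpha ->
  divides alpha (f * g) -> divides alpha f \/ divides alpha g.
Proof.
move=> alpha_lin; have [j cj] := linear_form_coeff alpha_lin.
case/andP: alpha_lin => /homog1E alphaE _.
pose s i : {mpoly K[n]} := 'X_i - (i == j)%:R *: ((alpha@_U_(j))^-1 *: alpha).
pose phi p := p \mPo [tuple s i | i < n].
have phiX i : phi 'X_i = s i.
  by rewrite /phi comp_mpolyXU -tnth_nth tnth_mktuple.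
have phi_alpha : phi alpha = 0.
  rewrite {1}alphaE /phi raddf_sum /=.
  under eq_bigr do rewrite comp_mpolyZ -[_ \mPo _]/(phi _) phiX scalerBr.
  rewrite sumrB -alphaE (bigD1 j) //= big1 => [|i /negPf ->]; last first.
    by rewrite !scale0r scaler0.
  by rewrite eqxx scale1r scalerA divff // scale1r addr0 subrr.
(* [phi] moves each variable by a multiple of [alpha], so it is the identity modulo [alpha]; on
   monomials this follows by telescoping the difference of two products. Hence [phi p = 0] forces
   [alpha] to divide p. *)
have phiB p : divides alpha (p - phi p).
  elim/mpolyind: p => [|c m p _ _ IHp].
    by rewrite /phi comp_mpoly0 subr0; apply: divides0.
  rewrite /phi [_ \mPo _]comp_mpolyD opprD addrACA; apply: dividesD => //.
  rewrite comp_mpolyZ -scalerBr -mul_mpolyC; apply: dividesMl.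
  rewrite comp_mpolyX mpolyXE_id.
  elim/big_rec2: _ => [|i a b _ ab]; first by rewrite subrr; apply: divides0.
  have -> : tnth [tuple s i | i < n] i = s i by rewrite tnth_mktuple.
  set x := _ ^+ _; set y := _ ^+ _.
  have -> : x * b - y * a = x * (b - a) + (x - y) * a by ring.
  apply: dividesD; first exact: dividesMl.
  apply: dividesMr; rewrite /x /y subrXX; apply: dividesMr.
  rewrite /s opprB addrC subrK -mul_mpolyC; apply/dividesMl.
  by rewrite -mul_mpolyC; apply/dividesMl/divides_refl.
case=> q /(congr1 phi); rewrite /phi !rmorphM /= -/(phi _) -![_ \mPo _]/(phi _).
rewrite phi_alpha mul0r => /eqP; rewrite mulf_eq0 => /orP[]/eqP phi0;
  [left; have := phiB f | right; have := phiB g]; by rewrite phi0 subr0.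
Qed.

Lemma linear_form_prime_prod (I : eqType) (s : seq I)
    (F : I -> {mpoly K[n]}) alpha : linear_form alpha ->
    divides alpha (\prod_(i <- s) F i) ->
  exists2 i, i \in s & divides alpha (F i).
Proof.
move=> alpha_lin; have [j cj] := linear_form_coeff alpha_lin.
elim: s => [|i s IHs].
  (* A linear form vanishes at the origin, so it cannot divide the empty product 1. *)
  rewrite big_nil => -[q /(congr1 (meval (fun=> 0)))].
  case/andP: alpha_lin => /homog1E -> _.
  rewrite meval1 mevalM raddf_sum /= big1 ?mul0r => [/eqP|k _].
    by rewrite oner_eq0.
  by rewrite mevalZ mevalXU mulr0.
rewrite big_cons => /(linear_form_prime alpha_lin)[|/IHs[k ks]].
  by exists i => //; rewrite mem_head.
by exists k => //; rewrite inE ks orbT.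
Qed.

(** Write g as the product over the tail times q. The head form is prime and divides no form of the
    tail, so it divides q. *)
Lemma prod_linear_form_divides (I : eqType) (s : seq I)
    (F : I -> {mpoly K[n]}) g : uniq s ->
    {in s, forall i, linear_form (F i)} ->
    {in s &, forall i j, divides (F i) (F j) -> i = j} ->
    {in s, forall i, divides (F i) g} ->
  divides (\prod_(i <- s) F i) g.
Proof.
elim: s => [|i s IHs] /=; first by rewrite big_nil; exists g; rewrite mul1r.
case/andP=> i_notin_s uniq_s lin_s inj_s div_s.
have sS : {subset s <= i :: s} by move=> j js; rewrite inE js orbT.
rewrite big_cons.
have [q gE] : divides (\prod_(j <- s) F j) g.
  apply: IHs => // [j /sS/lin_s //|j k /sS js /sS ks|j /sS/div_s //].
  exact: inj_s.
have := div_s i (mem_head _ _); rewrite gE.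
case/(linear_form_prime (lin_s i (mem_head _ _))).
  case/(linear_form_prime_prod (lin_s i (mem_head _ _))) => j js.
  move/(inj_s _ _ (mem_head _ _) (sS _ js)) => ij.
  by rewrite ij js in i_notin_s.
by case=> r ->; exists r; rewrite mulrCA mulrA.
Qed.

(* Evaluate at the points a_j e_i - a_i e_j, where a is the vector of
   coefficients of alpha and a_j != 0. *)
Lemma linear_form_proportional alpha beta :
    linear_form alpha -> linear_form beta ->
    (forall v, alpha.@[fun i => v 0 i] = 0 -> beta.@[fun i => v 0 i] = 0) ->
  exists2 c, c != 0 & beta = c *: alpha.
Proof.
move=> alpha_lin /andP[beta_hom beta_neq0] sub_ker.
have [j cj] := linear_form_coeff alpha_lin.
case/andP: alpha_lin => alpha_hom _.
pose v i : 'rV[K]_n :=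
  alpha@_U_(j) *: delta_mx 0 i - alpha@_U_(i) *: delta_mx 0 j.
have evalE p i : p \is 1.-homog -> p.@[fun k => v i 0 k]
    = p@_U_(i) * alpha@_U_(j) - p@_U_(j) * alpha@_U_(i).
  move=> p_hom; rewrite meval_homog1 //.
  under eq_bigr do rewrite !mxE !eqxx /= mulrBr.
  rewrite sumrB; congr (_ - _).
    rewrite (bigD1 i) //= big1 => [|k /negPf ->]; last by rewrite !mulr0.
    by rewrite eqxx mulr1 addr0.
  rewrite (bigD1 j) //= big1 => [|k /negPf ->]; last by rewrite !mulr0.
  by rewrite eqxx mulr1 addr0.
have coefE i : beta@_U_(i) = (beta@_U_(j) / alpha@_U_(j)) * alpha@_U_(i).
  have := sub_ker (v i); rewrite !evalE // mulrC subrr => /(_ erefl)/eqP.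
  by rewrite subr_eq0 => /eqP bE; rewrite mulrAC -bE mulfK.
set c := _ / _ in coefE.
have bE : beta = c *: alpha.
  apply/mpolyP => m; rewrite mcoeffZ (homog1E beta_hom) (homog1E alpha_hom).
  rewrite !raddf_sum mulr_sumr; apply: eq_bigr => i _ /=.
  by rewrite !mcoeffZ coefE mulrA.
exists c => //.
by apply: contra_neq beta_neq0 => c0; rewrite bE c0 scale0r.
Qed.

Lemma linear_form_divides_proportional alpha beta :
    linear_form alpha -> linear_form beta -> divides alpha beta ->
  exists2 c, c != 0 & beta = c *: alpha.
Proof.
move=> alpha_lin beta_lin ab; apply: linear_form_proportional => // v.
exact: meval_divides ab.
Qed.

End LinearForms.

(** * Derivations of a polynomial ring *)

Section Derivations.
Variables (K : fieldType) (n : nat).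
Implicit Types (d e : {mpoly K[n]} -> {mpoly K[n]}).

Section Theory.
Variable d : {mpoly K[n]} -> {mpoly K[n]}.
Hypothesis d_der : is_derivation d.

Lemma derivationD f g : d (f + g) = d f + d g.
Proof. by case: d_der => d_lin _; have := d_lin 1 f g; rewrite !scale1r. Qed.

Lemma derivation_0 : d 0 = 0.
Proof. by apply: (@addrI _ (d 0)); rewrite -derivationD !addr0. Qed.

Lemma derivationZ c f : d (c *: f) = c *: d f.
Proof.
by case: d_der => d_lin _; have := d_lin c f 0; rewrite derivation_0 !addr0.
Qed.

Lemma derivationB f g : d (f - g) = d f - d g.
Proof. by rewrite derivationD -[- g]scaleN1r derivationZ scaleN1r. Qed.

Lemma derivationM f g : d (f * g) = d f * g + f * d g.
Proof. by case: d_der. Qed.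

Lemma derivation_1 : d 1 = 0.
Proof.
by apply: (@addrI _ (d 1)); rewrite addr0 -{3}[1]mulr1 derivationM mulr1 mul1r.
Qed.

(** By the product rule d kills powers of variables, then monomials, then their linear
    combinations. *)
Lemma derivation_eq0 : (forall i, d 'X_i = 0) -> forall f, d f = 0.
Proof.
move=> dX; elim/mpolyind=> [|c m p _ _ dp]; first exact: derivation_0.
rewrite derivationD derivationZ dp addr0 mpolyXE_id.
suff -> : d (\prod_(i < n) 'X_i ^+ m i) = 0 by rewrite scaler0.
elim/big_rec: _ => [|i a _ da]; first exact: derivation_1.
rewrite derivationM da mulr0 addr0.
suff -> : d ('X_i ^+ m i) = 0 by rewrite mul0r.
elim: (m i) => [|k IHk]; first by rewrite expr0 derivation_1.
by rewrite exprS derivationM IHk dX mul0r mulr0 addr0.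
Qed.

(** Makes the logarithmic condition independent of the scaling of the form. *)
Lemma divides_derivZ c alpha : c != 0 ->
  divides (c *: alpha) (d (c *: alpha)) -> divides alpha (d alpha).
Proof.
move=> c_neq0 [q dE]; exists q; apply: (scalerI c_neq0).
by rewrite -derivationZ dE -scalerAl.
Qed.

End Theory.

Lemma derivation_mderiv i : is_derivation (mderiv i : {mpoly K[n]} -> _).
Proof. by split=> [|f g]; [exact: linearP|exact: mderivM]. Qed.

Lemma derivation_add d e : is_derivation d -> is_derivation e ->
  is_derivation (fun f => d f + e f).
Proof.
move=> d_der e_der; split=> [c f g|f g].
  rewrite (derivationD d_der) (derivationD e_der).
  rewrite (derivationZ d_der) (derivationZ e_der).
  by rewrite scalerDr addrACA.
by rewrite (derivationM d_der) (derivationM e_der); ring.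
Qed.

Lemma derivation_mul p d : is_derivation d -> is_derivation (fun f => p * d f).
Proof.
move=> d_der; split=> [c f g|f g].
  by rewrite (derivationD d_der) (derivationZ d_der) mulrDr scalerAr.
by rewrite (derivationM d_der); ring.
Qed.

Lemma derivation_sum (I : Type) (s : seq I)
    (F : I -> {mpoly K[n]} -> {mpoly K[n]}) :
  (forall i, is_derivation (F i)) ->
  is_derivation (fun f => \sum_(i <- s) F i f).
Proof.
move=> F_der; split=> [c f g|f g].
  rewrite scaler_sumr -big_split; apply: eq_bigr => i _ /=.
  by rewrite (derivationD (F_der i)) (derivationZ (F_der i)).
rewrite mulr_suml mulr_sumr -big_split; apply: eq_bigr => i _ /=.
by rewrite (derivationM (F_der i)).
Qed.

End Derivations.

Lemma mderivXU (K : fieldType) (n : nat) (i j : 'I_n) :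
  ('X_j : {mpoly K[n]})^`M(i) = (j == i)%:R.
Proof.
rewrite mderivX mnm1E; case: eqP => [->|_]; last by rewrite scale0r.
rewrite scale1r (_ : (_ - _)%MM = 0%MM) ?mpolyX0 //.
by apply/mnmP => k; rewrite mnmBE mnm0E subnn.
Qed.

Lemma dhomog_prod_const (K : fieldType) (n : nat) (I : eqType) (s : seq I)
    (F : I -> {mpoly K[n]}) :
  {in s, forall i, F i \is 1.-homog} ->
  \prod_(i <- s) F i \is (size s).-homog.
Proof.
elim: s => [|i s IHs] F_hom /=; first by rewrite big_nil dhomog1.
rewrite big_cons -add1n; apply: dhomogM; first by rewrite F_hom ?mem_head.
by apply: IHs => j js; rewrite F_hom // inE js orbT.
Qed.

(** * The coordinates x_i and z, and the linear forms built from them *)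

Section Coordinates.
Variables (K : fieldType) (l : nat).
Local Notation S := {mpoly K[l.+1]}.
Local Notation x := (@xvar K l).
Local Notation z := (@zvar K l).
Implicit Types (i j s t : nat) (a : K).

Lemma val_var_index i : (1 <= i <= l)%N -> val (var_index l i) = i.-1.
Proof. by move=> il; rewrite /= inordK //; lia. Qed.

Lemma var_index_eq i j : (1 <= i <= l)%N -> (1 <= j <= l)%N ->
  (var_index l i == var_index l j) = (i == j).
Proof. by move=> il jl; rewrite -val_eqE !val_var_index //; lia. Qed.

Lemma var_index_max i : (1 <= i <= l)%N -> (var_index l i == ord_max) = false.
Proof. by move=> il; rewrite -val_eqE val_var_index //=; lia. Qed.

Lemma var_ind (P : S -> Prop) :
  P z -> (forall i, (1 <= i <= l)%N -> P (x i)) -> forall k, P 'X_k.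
Proof.
move=> Pz Px k; have [kl|kl] := boolP (val k == l).
  by rewrite (_ : k = ord_max) //; apply/val_inj/eqP.
have il : (0 < k.+1 <= l)%N by move: kl (ltn_ord k) => /=; lia.
rewrite (_ : k = var_index l k.+1); first exact: Px.
by apply: val_inj; rewrite val_var_index.
Qed.

Lemma dx_xvar i j : (1 <= i <= l)%N -> (1 <= j <= l)%N ->
  dx i (x j) = (i == j)%:R.
Proof. by move=> il jl; rewrite /dx mderivXU var_index_eq // eq_sym. Qed.

Lemma dx_zvar i : (1 <= i <= l)%N -> dx i z = 0.
Proof. by move=> il; rewrite /dx mderivXU eq_sym var_index_max. Qed.

Lemma dz_xvar i : (1 <= i <= l)%N -> dz (x i) = 0.
Proof. by move=> il; rewrite /dz mderivXU var_index_max. Qed.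

Lemma dz_zvar : dz z = 1.
Proof. by rewrite /dz mderivXU eqxx. Qed.

Lemma sum_dx_xvar (G : nat -> S) m n s :
    (1 <= m)%N -> (n <= l.+1)%N -> (1 <= s <= l)%N ->
  \sum_(m <= i < n) G i * dx i (x s) = if (m <= s < n)%N then G s else 0.
Proof.
move=> m1 nl sl.
transitivity (\sum_(m <= i < n | i == s) G i); last exact: big_nat1_eq.
rewrite [RHS]big_mkcond; apply: eq_big_nat => i imn.
rewrite dx_xvar //; last lia.
by case: eqP => _; rewrite ?mulr1 ?mulr0.
Qed.

Lemma sum_dx_zvar (G : nat -> S) m n : (1 <= m)%N -> (n <= l.+1)%N ->
  \sum_(m <= i < n) G i * dx i z = 0.
Proof.
move=> m1 nl; rewrite big_nat big1 // => i imn.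
by rewrite dx_zvar ?mulr0 //; lia.
Qed.

Lemma meval_xvar (v : 'I_l.+1 -> K) i : (x i).@[v] = v (var_index l i).
Proof. exact: mevalXU. Qed.

Lemma meval_zvar (v : 'I_l.+1 -> K) : z.@[v] = v ord_max.
Proof. exact: mevalXU. Qed.

Lemma xvar_homog i : x i \is 1.-homog.
Proof. by rewrite dhomogX /= mdeg1. Qed.

Lemma zvar_homog : z \is 1.-homog.
Proof. by rewrite dhomogX /= mdeg1. Qed.

Lemma homog_xxz i j a : x i - x j - a *: z \is 1.-homog.
Proof. by rewrite !rpredB ?rpredZ ?xvar_homog ?zvar_homog. Qed.

Lemma homog_xx i j : x i - x j \is 1.-homog.
Proof. by rewrite rpredB ?xvar_homog. Qed.

Lemma linear_form_zvar : linear_form z.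
Proof.
rewrite /linear_form zvar_homog /=; apply/eqP => /(congr1 (meval (fun=> 1))).
by rewrite meval_zvar meval0 => /eqP; rewrite oner_eq0.
Qed.

Lemma linear_form_xxz i j a : (1 <= i <= l)%N -> (1 <= j <= l)%N -> i != j ->
  linear_form (x i - x j - a *: z).
Proof.
move=> il jl neq_ij; rewrite /linear_form homog_xxz /=; apply/eqP.
(* At the unit vector of x_i the form takes the value 1. *)
move/(congr1 (meval (fun k => (k == var_index l i)%:R))).
rewrite !mevalB mevalZ !meval_xvar meval_zvar meval0 eqxx.
rewrite !(eq_sym _ (var_index l i)) var_index_max // var_index_eq //.
rewrite (negPf neq_ij) mulr0 !subr0 => /eqP.
by rewrite oner_eq0.
Qed.

Lemma linear_form_xx i j : (1 <= i <= l)%N -> (1 <= j <= l)%N -> i != j ->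
  linear_form (x i - x j).
Proof.
move=> il jl neq_ij; have := linear_form_xxz 0 il jl neq_ij.
by rewrite scale0r subr0.
Qed.

End Coordinates.

(** * The derivations theta_k and the logarithmic conditions on the factors of [Q_N] *)

Section Theta.
Variables (K : fieldType) (l : nat) (N : nat -> {fset K}).
Local Notation S := {mpoly K[l.+1]}.
Local Notation x := (@xvar K l).
Local Notation z := (@zvar K l).
Local Notation theta := (@theta K l N).
Implicit Types (i j k s t : nat) (a : K) (d : S -> S).

(* The coefficient of d/dx_s in theta_k is the value at x_s of one polynomial
   that does not depend on s; it vanishes at x_s for s > k. *)
Definition theta_poly k : {poly S} :=
  (\prod_(a <- N k) ((x 1 - a *: z)%:P - 'X))
  * \prod_(k.+1 <= t < l.+1) ('X - (x t)%:P).

Lemma theta_polyE k y : (theta_poly k).[y] =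
  (\prod_(a <- N k) (x 1 - y - a *: z)) * \prod_(k.+1 <= t < l.+1) (y - x t).
Proof.
rewrite hornerM !horner_prod; congr (_ * _); apply: eq_bigr => a _.
  by rewrite !hornerE addrAC.
by rewrite !hornerE.
Qed.

Lemma theta_poly_xvar_gt k s : (k < s <= l)%N -> (theta_poly k).[x s] = 0.
Proof.
move=> ksl; rewrite theta_polyE (big_rem s) /=; last first.
  by rewrite mem_index_iota; lia.
by rewrite subrr mul0r mulr0.
Qed.

Lemma theta0_xvar s : (1 <= s <= l)%N -> theta 0 (x s) = 1.
Proof.
move=> sl /=.
have := sum_dx_xvar (fun=> 1) (leqnn 1) (leqnn l.+1) sl; rewrite ltnS sl => <-.
by apply: eq_bigr => i _; rewrite mul1r.
Qed.

Lemma theta0_zvar : theta 0 z = 0.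
Proof.
rewrite /= -[RHS](@sum_dx_zvar K l (fun=> 1) 1 l.+1 isT (leqnn _)).
by apply: eq_bigr => i _; rewrite mul1r.
Qed.

Lemma theta1_xvar s : (1 <= s <= l)%N -> theta 1 (x s) = x s.
Proof.
by move=> sl; rewrite /= sum_dx_xvar // dz_xvar // mulr0 addr0 ltnS sl.
Qed.

Lemma theta1_zvar : theta 1 z = z.
Proof. by rewrite /= sum_dx_zvar // dz_zvar mulr1 add0r. Qed.

Lemma thetaE k f : (2 <= k)%N ->
  theta k f = \sum_(2 <= s < k.+1) (theta_poly k).[x s] * dx s f.
Proof.
by case: k => [|[|k]] // _; apply: eq_bigr => s _; rewrite theta_polyE.
Qed.

Lemma theta_xvar1 k : (2 <= k <= l)%N -> theta k (x 1) = 0.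
Proof. by move=> kl; rewrite thetaE ?sum_dx_xvar //; lia. Qed.

Lemma theta_xvar k s : (2 <= k <= l)%N -> (2 <= s <= l)%N ->
  theta k (x s) = (theta_poly k).[x s].
Proof.
move=> kl sl; rewrite thetaE ?sum_dx_xvar; try lia.
case: ifP => // ks; rewrite theta_poly_xvar_gt //; lia.
Qed.

Lemma theta_zvar k : (2 <= k <= l)%N -> theta k z = 0.
Proof. by move=> kl; rewrite thetaE ?sum_dx_zvar //; lia. Qed.

Lemma derivation_theta k : is_derivation (theta k).
Proof.
case: k => [|[|k]].
- by apply: derivation_sum => i; apply: derivation_mderiv.
- apply: derivation_add; last exact/derivation_mul/derivation_mderiv.
  by apply: derivation_sum => i; apply/derivation_mul/derivation_mderiv.
by apply: derivation_sum => i; apply/derivation_mul/derivation_mderiv.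
Qed.

(** The claimed exponents, indexed by k; the truncated subtraction is exact for k <= l. *)
Definition theta_deg k : nat :=
  match k with 0 => 0 | 1 => 1 | _ => (#|` N k| + (l - k))%N end.

Lemma homogeneous_theta k : (k <= l)%N ->
  homogeneous_derivation (theta_deg k) (theta k).
Proof.
move=> kl; apply: (@var_ind K l (fun p => theta k p \is (theta_deg k).-homog)).
  case: k kl => [|[|k]] kl; first by rewrite theta0_zvar rpred0.
    by rewrite theta1_zvar zvar_homog.
  by rewrite theta_zvar // rpred0.
move=> s sl; case: k kl => [|[|k]] kl; first by rewrite theta0_xvar // dhomog1.
  by rewrite theta1_xvar // xvar_homog.
(* The sum defining theta_k starts at s = 2, so x_1 is killed and is not covered by the formula with
   [theta_poly]. *)
have [->|s_neq1] := eqVneq s 1%N; first by rewrite theta_xvar1 // rpred0.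
rewrite theta_xvar //; last lia.
rewrite theta_polyE; apply: dhomogM.
  by apply: dhomog_prod_const => a _; apply: homog_xxz.
(* The index is now [k.+2], so the second product starts at [k.+3]; the degree is rewritten as the
   length of its range. *)
rewrite -subSS -(size_iota k.+3 (l.+1 - k.+3)).
by apply: dhomog_prod_const => t _; apply: homog_xx.
Qed.

(** The logarithmic condition tested on the explicit factors of [Q_N] instead of on abstract
    hyperplanes and their forms. *)
Definition logarithmic_on_factors d :=
  [/\ divides z (d z),
      forall j a, (2 <= j <= l)%N -> a \in N j ->
        divides (x 1 - x j - a *: z) (d (x 1 - x j - a *: z))
    & forall i j, (2 <= i)%N -> (i < j <= l)%N ->
        divides (x i - x j) (d (x i - x j))].

(** [Q_N] is a product of primes in two ways, over the hyperplanes and over the explicit factors.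
    Primality matches the forms of one product with those of the other up to nonzero scalars, which
    do not affect the condition. *)
Lemma logarithmic_derivationP (A : central_arrangement K l.+1) d :
    (2 <= l)%N -> defining_polynomial A (Q_N l N) -> is_derivation d ->
  logarithmic_derivation A d <-> logarithmic_on_factors d.
Proof.
move=> l_ge2 [alpha [alpha_form QE]] d_der.
have alpha_lin H : H \in hyperplanes A -> linear_form (alpha H).
  by case/alpha_form => hom nz _; rewrite /linear_form hom.
split=> [[_ d_log]|[d_z d_xxz d_xx]].
  (* A linear form dividing [Q_N] divides some [alpha H], hence is proportional to it and inherits
     its condition. *)
  have d_fact beta : linear_form beta -> divides beta (Q_N l N) ->
      divides beta (d beta).
    move=> beta_lin; rewrite QE => /(linear_form_prime_prod beta_lin)[H AH].
    move/(linear_form_divides_proportional beta_lin (alpha_lin _ AH)).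
    case=> c c0 aE.
    apply: (divides_derivZ d_der c0); rewrite -aE.
    exact: d_log (alpha_form H AH).
  split=> [|j a jl aN|i j i2 ij]; apply: d_fact.
  - exact: linear_form_zvar.
  - by rewrite /Q_N -mulrA; apply/dividesMr/divides_refl.
  - by apply: linear_form_xxz; lia.
  - rewrite /Q_N -mulrA; apply/dividesMl/dividesMr.
    apply: (@divides_trans _ (\prod_(a <- N j) (x 1 - x j - a *: z))).
      exact: (divides_prod (fun a => x 1 - x j - a *: z)).
    apply: (divides_prod (fun j => \prod_(a <- N j) (x 1 - x j - a *: z))).
    by rewrite mem_index_iota; lia.
  - by apply: linear_form_xx; lia.
  rewrite /Q_N; apply: dividesMl.
  apply: (@divides_trans _ (\prod_(i.+1 <= j < l.+1) (x i - x j))).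
    by apply: (divides_prod (fun j => x i - x j)); rewrite mem_index_iota; lia.
  apply: (divides_prod (fun i => \prod_(i.+1 <= j < l.+1) (x i - x j))).
  by rewrite mem_index_iota; lia.
split=> // H beta AH [beta_hom beta_neq0 betaE].
have beta_lin : linear_form beta by rewrite /linear_form beta_hom.
have d_fact gamma : linear_form gamma -> divides gamma (d gamma) ->
    divides beta gamma -> divides beta (d beta).
  move=> gamma_lin d_gamma.
  case/(linear_form_divides_proportional beta_lin gamma_lin) => c c0 gE.
  apply: (divides_derivZ d_der c0); rewrite -gE //.
(* [beta] and [alpha H] vanish on the same hyperplane, so they are proportional, and [alpha H] is a
   factor of [Q_N]. *)
have : divides beta (Q_N l N).
  have [_ _ alphaE] := alpha_form H AH.
  have [|c c0 aE] :=
    @linear_form_proportional _ _ _ _ beta_lin (alpha_lin H AH).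
    by move=> v /eqP; rewrite -betaE alphaE => /eqP.
  apply: (@divides_trans _ (alpha H)).
    by rewrite aE -mul_mpolyC; apply/dividesMl/divides_refl.
  by rewrite QE; apply: divides_prod.
rewrite /Q_N; case/(linear_form_prime beta_lin).
  case/(linear_form_prime beta_lin).
    exact: d_fact (linear_form_zvar _ _) d_z.
  case/(linear_form_prime_prod beta_lin) => j; rewrite mem_index_iota => jl.
  case/(linear_form_prime_prod beta_lin) => a aN.
  by apply: d_fact; [apply: linear_form_xxz; lia | apply: d_xxz].
case/(linear_form_prime_prod beta_lin) => i; rewrite mem_index_iota => il.
case/(linear_form_prime_prod beta_lin) => j; rewrite mem_index_iota => jl.
by apply: d_fact; [apply: linear_form_xx; lia | apply: d_xx; lia].
Qed.

End Theta.

(** * Membership, spanning and independence of the theta_k *)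

Section Basis.
Variables (K : fieldType) (l : nat) (N : nat -> {fset K}).
Local Notation S := {mpoly K[l.+1]}.
Local Notation x := (@xvar K l).
Local Notation z := (@zvar K l).
Local Notation theta := (@theta K l N).
Local Notation theta_poly := (@theta_poly K l N).
Local Notation log_on_factors := (@logarithmic_on_factors K l N).
Implicit Types (i j k m s t : nat) (a : K) (d e : S -> S) (p : S).

(** The shape d + p e is the one in which multiples of theta_k are subtracted below. *)
Lemma logarithmic_on_factorsD p d e :
  log_on_factors d -> log_on_factors e ->
  log_on_factors (fun f => d f + p * e f).
Proof.
case=> d_z d_xxz d_xx [e_z e_xxz e_xx]; split=> [|j a jl aN|i j i2 ij].
- exact/dividesD/dividesMl.
- by apply/dividesD/dividesMl; [apply: d_xxz | apply: e_xxz].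
- by apply/dividesD/dividesMl; [apply: d_xx | apply: e_xx].
Qed.

Section Logarithmic.
Hypothesis N_chain : forall j,
  (2 <= j)%N -> (j < l)%N -> (N j `<=` N j.+1)%fset.

Lemma N_chain_fsubset i j : (2 <= i)%N -> (i <= j <= l)%N ->
  (N i `<=` N j)%fset.
Proof.
move=> i2; elim: j => [|j IHj] ij; first by lia.
have [->|neq_ij] := eqVneq i j.+1; first exact: fsubset_refl.
by apply: fsubset_trans (N_chain _ _); try lia; apply: IHj; lia.
Qed.

Lemma theta_poly_divisible k j a : (2 <= k <= l)%N -> (2 <= j <= l)%N ->
  a \in N j -> divides (x 1 - x j - a *: z) (theta_poly k).[x j].
Proof.
move=> kl jl aN; have [kj|jk] := ltnP k j.
  by rewrite theta_poly_xvar_gt; [apply: divides0 | lia].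
rewrite theta_polyE; apply: dividesMr.
apply: (divides_prod (fun a => x 1 - x j - a *: z)).
by apply: (fsubsetP (@N_chain_fsubset j k _ _)) aN; lia.
Qed.

(** theta_0 kills z and the differences of the x_i, and theta_1 fixes every linear form. For k >= 2,
    theta_k kills z and x_1, so x_1 - x_j - a z goes to minus the value of [theta_poly] at x_j,
    while x_i - x_j goes to a difference of two values of one polynomial. *)
Lemma logarithmic_theta k : (k <= l)%N -> log_on_factors (theta k).
Proof.
move=> kl; have der := @derivation_theta K l N k.
split=> [|j a jl aN|i j i2 ij]; rewrite ?(derivationB der) ?(derivationZ der).
- case: k kl {der} => [|[|k]] kl; first by rewrite theta0_zvar; apply: divides0.
    by rewrite theta1_zvar; apply: divides_refl.
  by rewrite theta_zvar; [apply: divides0 | lia].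
- case: k kl {der} => [|[|k]] kl.
  + rewrite !theta0_xvar ?theta0_zvar; try lia.
    by rewrite scaler0 subrr subr0; apply: divides0.
  + rewrite !theta1_xvar ?theta1_zvar; try lia.
    exact: divides_refl.
  rewrite theta_xvar1 ?theta_zvar ?theta_xvar; try lia.
  rewrite scaler0 sub0r subr0; apply/dividesN/theta_poly_divisible => //; lia.
case: k kl {der} => [|[|k]] kl.
- by rewrite !theta0_xvar; try lia; rewrite subrr; apply: divides0.
- by rewrite !theta1_xvar; try lia; apply: divides_refl.
by rewrite !theta_xvar; try lia; apply: divides_hornerB.
Qed.

End Logarithmic.

Lemma theta_poly_neq0 k : (2 <= k <= l)%N -> (theta_poly k).[x k] != 0.
Proof.
move=> kl; rewrite theta_polyE; apply: mulf_neq0; rewrite prodf_seq_neq0.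
  apply/allP => a _ /=.
  have /andP[//] : linear_form (x 1 - x k - a *: z).
  by apply: linear_form_xxz; lia.
apply/allP => t; rewrite mem_index_iota => tl /=.
by have /andP[] : linear_form (x k - x t) by apply: linear_form_xx; lia.
Qed.

(** The factors indexed by [N k] are divided out first. Each x_k - x_t then divides the cofactor q,
    because it is prime and divides none of those factors. *)
Lemma theta_poly_divides_diag d k : (2 <= k <= l)%N ->
    is_derivation d -> log_on_factors d ->
    d z = 0 -> d (x 1) = 0 -> (forall s, (k < s <= l)%N -> d (x s) = 0) ->
  divides (theta_poly k).[x k] (d (x k)).
Proof.
move=> kl d_der [_ d_xxz d_xx] dz0 dx1 dxs; rewrite theta_polyE.
have [q dE] : divides (\prod_(a <- N k) (x 1 - x k - a *: z)) (d (x k)).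
  apply: prod_linear_form_divides => [|a _|a b _ _|a aN].
  - exact: fset_uniq.
  - by apply: linear_form_xxz; lia.
  (* At the point x_1 = a, z = 1, all other coordinates 0, the form for a vanishes and the form for
     b takes the value a - b. *)
  - move/(@meval_divides _ _ _ _
      (fun i : 'I_l.+1 => a *+ (i == var_index l 1) + (i == ord_max)%:R)).
    rewrite !mevalB !mevalZ !meval_xvar !meval_zvar !eqxx.
    rewrite [ord_max == _]eq_sym !var_index_max; try lia.
    rewrite var_index_eq; try lia.
    rewrite (_ : (k == 1%N) = false); last lia.
    rewrite !mulr0n !mulr1n !addr0 add0r !mulr1 !subr0 subrr => /(_ erefl)/eqP.
    by rewrite subr_eq0 => /eqP.
  have := d_xxz k a kl aN.
  rewrite !(derivationB d_der) (derivationZ d_der) dz0 dx1 scaler0 subr0 sub0r.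
  by move/dividesN; rewrite opprK.
(* The point x_k = x_t = 1 with all other coordinates 0: x_k - x_t vanishes there, but x_k - x_t' is
   1 for the other t' > k, and x_1 - x_k - a z is -1. *)
pose v t (i : 'I_l.+1) : K := ((i == var_index l k) || (i == var_index l t))%:R.
have v0 t : (x k - x t).@[v t] = 0.
  by rewrite mevalB !meval_xvar /v !eqxx orbT subrr.
have [r qE] : divides (\prod_(k.+1 <= t < l.+1) (x k - x t)) q.
  apply: prod_linear_form_divides => [|t|t t'|t]; first exact: iota_uniq.
  - by rewrite mem_index_iota => tl; apply: linear_form_xx; lia.
  - rewrite !mem_index_iota => tl tl' /meval_divides/(_ (v0 t))/eqP.
    rewrite mevalB !meval_xvar /v eqxx !var_index_eq; try lia.
    rewrite (_ : (t' == k) = false); last lia.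
    by case: (t' =P t) => [-> |_] //=; rewrite subr0 oner_eq0.
  rewrite mem_index_iota => tl.
  have xk_lin : linear_form (x k - x t) by apply: linear_form_xx; lia.
  have : divides (x k - x t) (d (x k)).
    have := d_xx k t _ _; rewrite (derivationB d_der) (dxs t); last lia.
    by rewrite subr0; apply; lia.
  rewrite dE => /(linear_form_prime xk_lin)[|//].
  case/(linear_form_prime_prod xk_lin) => a _ /meval_divides/(_ (v0 t))/eqP.
  rewrite !mevalB mevalZ !meval_xvar meval_zvar /v eqxx.
  rewrite ![ord_max == _]eq_sym !var_index_max ?var_index_eq; try lia.
  rewrite (_ : (1%N == k) = false); last lia.
  rewrite (_ : (1%N == t) = false); last lia.
  by rewrite mulr0 subr0 sub0r oppr_eq0 oner_eq0.
by exists r; rewrite dE qE mulrA.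
Qed.

(** Induction on m: the multiple of theta_m that corrects x_m does not disturb the values at z, x_1
    and x_s for s > m. *)
Lemma theta_span d m : (1 <= m <= l)%N -> is_derivation d -> log_on_factors d ->
    (forall k, (2 <= k <= l)%N -> log_on_factors (theta k)) ->
    d z = 0 -> d (x 1) = 0 -> (forall s, (m < s <= l)%N -> d (x s) = 0) ->
  exists c : nat -> S, forall f, d f = \sum_(2 <= k < m.+1) c k * theta k f.
Proof.
move=> ml d_der d_log theta_log; elim: m => [|m IHm] in d ml d_der d_log *.
  by lia.
(* The induction effectively starts at 1, where d kills every variable and the sum is empty. *)
move=> dz0 dx1 dxs; have [m0|m_neq0] := eqVneq m 0%N.
  exists (fun=> 0) => f; rewrite m0 big_geq //; apply: derivation_eq0 => //.
  apply: (@var_ind K l (fun p => d p = 0)) => // s sl.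
  have [-> //|s_neq1] := eqVneq s 1%N; apply: dxs; lia.
set k := m.+1 in ml dxs; have kl : (2 <= k <= l)%N by rewrite /k; lia.
have [q dE] := theta_poly_divides_diag kl d_der d_log dz0 dx1 dxs.
pose d' f := d f + (- q) * theta k f.
have [||||||c d'E] := IHm d'.
- by lia.
- by apply: derivation_add => //; apply/derivation_mul/derivation_theta.
- by apply: logarithmic_on_factorsD => //; apply: theta_log.
- by rewrite /d' theta_zvar // dz0 mulr0 addr0.
- by rewrite /d' theta_xvar1 // dx1 mulr0 addr0.
- move=> s sl; rewrite /d' theta_xvar //; last lia.
  have [->|s_neqk] := eqVneq s k; first by rewrite dE mulNr mulrC subrr.
  by rewrite dxs ?theta_poly_xvar_gt ?mulr0 ?addr0 // /k; lia.
exists (fun i => if i == k then q else c i) => f.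
rewrite big_nat_recr /=; last lia.
rewrite eqxx; have -> : d f = d' f + q * theta k f by rewrite /d' mulNr subrK.
rewrite d'E; congr (_ + _); apply: eq_big_nat => i im.
by rewrite ifF // /k; lia.
Qed.

Lemma sum_thetaE (c : nat -> S) f : (1 <= l)%N ->
  \sum_(k < l.+1) c k * theta k f =
  c 0%N * theta 0 f
    + (c 1%N * theta 1 f + \sum_(2 <= k < l.+1) c k * theta k f).
Proof.
move=> l1; rewrite -(big_mkord xpredT (fun k => c k * theta k f)).
by rewrite big_ltn // big_ltn.
Qed.

Lemma theta_spanning d : (2 <= l)%N -> is_derivation d -> log_on_factors d ->
    (forall k, (k <= l)%N -> log_on_factors (theta k)) ->
  exists c : 'I_l.+1 -> S, forall f, d f = \sum_k c k * theta k f.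
Proof.
move=> l2 d_der d_log theta_log; have [[q dz_q] _ _] := d_log.
(* theta_1 z = z and d z = z q, so [d1] kills z. As theta_0 z = 0 and theta_0 x_1 = 1, [d2] kills
   both z and x_1. *)
pose d1 f := d f + (- q) * theta 1 f.
pose d2 f := d1 f + (- d1 (x 1)) * theta 0 f.
have d1_der : is_derivation d1.
  by apply: derivation_add => //; apply/derivation_mul/derivation_theta.
have d1_log : log_on_factors d1.
  by apply: logarithmic_on_factorsD => //; apply: theta_log; lia.
(* With m = l the vanishing condition on later variables is vacuous. *)
have [|||||||c d2E] := @theta_span d2 l.
- by lia.
- by apply: derivation_add => //; apply/derivation_mul/derivation_theta.
- by apply: logarithmic_on_factorsD => //; apply: theta_log.
- by move=> k kl; apply: theta_log; lia.
- rewrite /d2 /d1 theta0_zvar theta1_zvar dz_q mulr0 addr0.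
  by rewrite mulNr mulrC subrr.
- by rewrite /d2 theta0_xvar ?mulr1 ?subrr //; lia.
- by move=> s; lia.
pose c' k := match k with 0 => d1 (x 1) | 1 => q | _ => c k end.
exists (fun k => c' k) => f; rewrite sum_thetaE; last lia.
have -> : d f = d2 f + d1 (x 1) * theta 0 f + q * theta 1 f.
  by rewrite /d2 mulNr subrK /d1 mulNr subrK.
rewrite d2E /= -addrA addrC addrA; congr (_ + _).
by apply: eq_big_nat => -[|[|k]].
Qed.

Lemma theta_free (c : 'I_l.+1 -> S) : (2 <= l)%N ->
  (forall f, \sum_k c k * theta k f = 0) -> forall k : 'I_l.+1, c k = 0.
Proof.
(* Coefficients are extended to all naturals so that the terms 0 and 1 can be split off; applying
   the relation to z, then x_1, isolates [C 1], then [C 0]. *)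
move=> l2 c0; pose C k := c (inord k).
have C0 f : C 0%N * theta 0 f
    + (C 1%N * theta 1 f + \sum_(2 <= k < l.+1) C k * theta k f) = 0.
  rewrite -sum_thetaE; last lia.
  by rewrite -[RHS](c0 f); apply: eq_bigr => k _; rewrite /C inord_val.
have C1_eq0 : C 1%N = 0.
  have := C0 z; rewrite theta0_zvar theta1_zvar mulr0 add0r.
  rewrite big_nat big1 => [|k kl].
    move/eqP; rewrite addr0 mulf_eq0 => /orP[/eqP //|].
    by have /andP[_ /negPf ->] := linear_form_zvar K l.
  by rewrite theta_zvar ?mulr0.
have C0_eq0 : C 0%N = 0.
  have := C0 (x 1); rewrite C1_eq0 mul0r add0r theta0_xvar; last lia.
  rewrite mulr1 big_nat big1 ?addr0 // => k kl.
  by rewrite theta_xvar1 ?mulr0.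
(* Descending induction on k, with n exceeding l - k. In the relation at x_k, terms of index below k
   vanish since theta_i x_k = 0 for i < k, and terms above k by induction. *)
have Ck_eq0 n k : (l < k + n)%N -> (2 <= k <= l)%N -> C k = 0.
  elim: n k => [|n IHn] k kn kl; first by lia.
  have := C0 (x k); rewrite C0_eq0 C1_eq0 !mul0r !add0r.
  rewrite (bigD1_seq k) ?iota_uniq ?mem_index_iota //=.
  rewrite big_seq_cond big1 => [|i /andP[]].
    rewrite addr0 theta_xvar // => /eqP; rewrite mulf_eq0.
    by rewrite (negPf (theta_poly_neq0 kl)) orbF => /eqP.
  rewrite mem_index_iota => il neq_ik; have [ik|ki] := ltnP i k.
    by rewrite theta_xvar // theta_poly_xvar_gt ?mulr0 //; lia.
  by rewrite IHn ?mul0r //; lia.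
move=> k; rewrite -[k]inord_val -/(C k); case: k => -[|[|k]] kl //=.
by apply: (Ck_eq0 l); lia.
Qed.

End Basis.

(** * The basis theorem, freeness and exponents *)

Local Open Scope fset_scope.

Theorem theorem1p4 (K : fieldType) (charK0 : [pchar K] =i pred0)
    (l : nat) (l_ge2 : (2 <= l)%N) (N : nat -> {fset K})
    (N_chain : forall j, (2 <= j)%N -> (j < l)%N -> N j `<=` N j.+1)
    (I_N : central_arrangement K l.+1)
    (I_N_def : defining_polynomial I_N (Q_N l N)) :
  [/\ is_basis (logarithmic_derivation I_N)
        (fun k : 'I_l.+1 => @theta K l N k),
      free_arrangement I_N
    & has_exponents I_N
        ([:: 0; 1] ++ [seq #|` N k| + (l - k) | k <- iota 2 l.-1])%N].
Proof.
have theta_log k := logarithmic_theta N_chain (k := k).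
have logP d := logarithmic_derivationP (d := d) l_ge2 I_N_def.
have basis : is_basis (logarithmic_derivation I_N)
    (fun k : 'I_l.+1 => @theta K l N k).
  split=> [k|d d_log|c c0].
  - by apply/logP; [exact: derivation_theta | apply: theta_log; rewrite -ltnS].
  - have d_der : is_derivation d by case: d_log.
    by apply: (theta_spanning (N := N)) => //; apply/(logP d d_der).
  - exact: theta_free c0.
split=> //; first by exists l.+1, (fun k : 'I_l.+1 => @theta K l N k).
exists l.+1, (fun k : 'I_l.+1 => @theta K l N k).
exists (fun k : 'I_l.+1 => theta_deg l N k); split=> // [k|].
  by apply: homogeneous_theta; rewrite -ltnS.
(* Listing the degrees over 0, ..., l as naturals lets the exponents 0 and 1 split off; from index 2
   on only the last branch of [theta_deg] occurs. *)
have -> : codom (fun k : 'I_l.+1 => theta_deg l N k)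
    = [seq theta_deg l N k | k <- iota 0 l.+1].
  by rewrite -val_enum_ord -map_comp codomE.
rewrite (_ : iota 0 l.+1 = [:: 0, 1 & iota 2 l.-1]%N) /=; last first.
  by case: (l) l_ge2.
rewrite (_ : map _ _ = [seq theta_deg l N k | k <- iota 2 l.-1]) ?perm_refl //.
by apply/eq_in_map => -[|[|k]]; rewrite mem_iota.
Qed.
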